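(* Let $R$ be an associative ring with unity equipped with a pseudo-involution $r\mapsto\bar r$, and let $m,n\ge 1$ be integers. Let $(V_0,q_0)$ be an odd quadratic space over $R$, where $q_0=(\langle\,,\rangle_0,\mathfrak L_0)$, such that $V_0$ is a free right $R$-module of rank $n$ with a fixed basis and the $n\times n$ matrix $\varphi$ of the form $\langle\,,\rangle_0$ in this basis is invertible. For $v\in R^{n+2m-1}$ let $\theta(v)$ and $\eta(v)$ be the $(n+2m-1)\times(n+2m-1)$ matrices $$\theta(v)=I_{n+2m-1}+d^{t}\,\overline{v}\,\mu,\qquad \eta(v)=I_{n+2m-1}-\bar 1^{-1}\rho\,\overline{v}^{\,t}c$$ of the Vaserstein-type construction for the odd unitary group of $\mathbb H^m\oplus V_0$ (with $c,d,\mu,\rho$ as defined in the context). Then the group generated by all the matrices $\theta(v)$ and $\eta(v)$, $v\in R^{n+2m-1}$, coincides with the elementary linear group $\mathrm E_{n+2m-1}(R)$.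
   Context: **Pseudo-involution.** A pseudo-involution on an associative unital ring $R$ is an additive map $R\to R$, $r\mapsto\bar r$, such that $\bar 1$ is invertible, $\overline{r_1r_2}=\bar r_2\,\bar 1^{-1}\,\bar r_1$ and $\bar{\bar r}=r$ for all $r,r_1,r_2\in R$. ($\bar 1^{-1}$ denotes the inverse of $\bar 1$.) **Anti-Hermitian forms.** A sesquilinear form on a right $R$-module $V$ is a biadditive map $\langle\,,\rangle:V\times V\to R$ with $\langle v_1r,v_2s\rangle=\bar r\,\bar 1^{-1}\langle v_1,v_2\rangle s$ for all $v_1,v_2\in V$ and $r,s\in R$. It is anti-Hermitian if $\langle v_1,v_2\rangle=-\overline{\langle v_2,v_1\rangle}$ for all $v_1,v_2$. The matrix of such a form in a basis $(f_i)$ is $(\langle f_i,f_j\rangle)_{i,j}$. **Odd quadratic spaces.** Given an anti-Hermitian form on $V$, the Heisenberg group is $\mathfrak H=V\times R$ with the operation $(v_1,r)\dot+(v_2,s)=(v_1+v_2,\,r+s+\langle v_1,v_2\rangle)$. The ring $R$ acts on it on the right by $(v,r)\leftharpoonup s=(vs,\bar s\,\bar 1^{-1}rs)$, and the trace is $tr((v,r))=r-\bar r-\langle v,v\rangle$. Let $\mathfrak L_{\min}=\{(0,r+\bar r):r\in R\}$ and $\mathfrak L_{\max}=\{\zeta\in\mathfrak H:tr(\zeta)=0\}$. An odd form parameter is a subgroup $\mathfrak L$ of $\mathfrak H$ with $\mathfrak L_{\min}\le\mathfrak L\le\mathfrak L_{\max}$ that is stable under the action of $R$. Then $q=(\langle\,,\rangle,\mathfrak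 L)$ is called an odd quadratic form and $(V,q)$ an odd quadratic space. **Hyperbolic space.** $\mathbb H$ is the odd quadratic space spanned by $e_1,e_{-1}$ with $\langle e_1,e_{-1}\rangle=1$, $\langle e_1,e_1\rangle=\langle e_{-1},e_{-1}\rangle=0$, and odd form parameter generated by $(e_1,0)$ and $(e_{-1},0)$. $\mathbb H^m$ is the orthogonal sum of $m$ copies of $\mathbb H$. **The Vaserstein-type construction.** Write $A\perp B$ for the block diagonal matrix with blocks $A,B$. Put $\widetilde\psi_1=\begin{pmatrix}0&1\\-\bar 1&0\end{pmatrix}$ and $\widetilde\psi_r=\widetilde\psi_1\perp\widetilde\psi_{r-1}$ for $r>1$. Put $\widetilde\psi'_1=\begin{pmatrix}0&-\bar 1^{-1}\\1&0\end{pmatrix}$ and $\widetilde\psi'_r=\widetilde\psi'_1\perp\widetilde\psi'_{r-1}$ for $r>1$. The matrices $\widetilde\psi_0,\widetilde\psi'_0$ are empty. The form matrix of $\mathbb H^m\oplus V_0$ is $\Psi=\widetilde\psi_m\perp\varphi$, of size $n+2m$. One writes $$\Psi=\begin{pmatrix}0&c\\-\bar 1c^t&\mu\end{pmatrix},\qquad \Psi^{-1}=\begin{pmatrix}0&d\\-\bar 1d^t&\rho\end{pmatrix},$$ where $c=(1,0,\ldots,0)$ and $d=(-\bar 1^{-1},0,\ldots,0)$ are row vectors in $R^{n+2m-1}$, and $$\mu=\begin{pmatrix}0&0&0\\0&\widetilde\psi_{m-1}&0\\0&0&\varphi\end{pmatrix},\qquad \rho=\begin{pmatrix}0&0&0\\0&\widetilde\psi'_{m-1}&0\\0&0&\varphi^{-1}\end{pmatrix}$$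 are square matrices of size $n+2m-1$, whose upper-left zero block is $1\times1$. Elements $v=(a_1,\ldots,a_{n+2m-1})\in R^{n+2m-1}$ are row vectors, $\overline v=(\bar a_1,\ldots,\bar a_{n+2m-1})$, and $^t$ denotes transpose. The matrices $\theta(v)$ and $\eta(v)$ are the lower right blocks of $L(v)=\begin{pmatrix}1&0\\ {v}^t&\theta(v)\end{pmatrix}$ and $L(v)^*=\begin{pmatrix}1&v\\0&\eta(v)\end{pmatrix}$. **Elementary linear group.** $\mathrm E_N(R)$ is the subgroup of $\mathrm{GL}_N(R)$ generated by the elementary matrices $E_{i,j}(a)$, $1\le i\neq j\le N$, $a\in R$. Here $E_{i,j}(a)$ is the matrix that has $1$'s on the diagonal, $a$ in position $(i,j)$, and $0$ elsewhere. *)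

(* Defs.v *)
From HB Require Import structures.
From mathcomp Require Import all_boot all_order all_algebra.
From mathcomp Require Import classical_sets.

Set Implicit Arguments.
Unset Strict Implicit.
Unset Printing Implicit Defensive.

Import GRing.Theory.
Local Open Scope ring_scope.

(* Right R-modules are left modules over the converse ring [R^c]: the element
   "v r" of the right module is [v *:r r], i.e. [(r : R^c) *: v]. *)
Notation rightModType R := (GRing.Lmodule.type (R : pzRingType)^c).
Notation "v *:r r" := (@GRing.scale (_ : pzRingType)^c _ r v)
  (at level 40, left associativity) : ring_scope.

Lemma rscaleA (R : pzRingType) (V : rightModType R) (v : V) (r s : R) :
  (v *:r r) *:r s = v *:r (r * s).
Proof. exact: scalerA. Qed.

Record is_subgroup (G : groupType) (H : set G) : Prop := IsSubgroup {
  subgroup1 : H 1%g;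
  subgroupM : forall x y, H x -> H y -> H (x * y)%g;
  subgroupV : forall x, H x -> H (x^-1)%g }.

Definition generated (G : groupType) (X : set G) : set G :=
  smallest (@is_subgroup G) X.

(* An element of GL_n(R) is stored together with its (unique) inverse;
   equality is equality of the underlying matrices, see [GL_inj]. *)
Record GL (R : pzRingType) (n : nat) := MkGL {
  GLpair : 'M[R]_n * 'M[R]_n;
  GLpairP : (GLpair.1 *m GLpair.2 == 1%:M) && (GLpair.2 *m GLpair.1 == 1%:M) }.

HB.instance Definition _ (R : pzRingType) n := [isSub for @GLpair R n].
HB.instance Definition _ (R : pzRingType) n := [Choice of GL R n by <:].

Section GLGroup.
Context {R : pzRingType} {n : nat}.
Implicit Types A B C : GL R n.

Definition GLmx A : 'M[R]_n := (GLpair A).1.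

Definition toGL (A B : 'M[R]_n) (AB : A *m B = 1%:M) (BA : B *m A = 1%:M) :
  GL R n := @MkGL R n (A, B) (introT andP (conj (introT eqP AB) (introT eqP BA))).

Lemma GL_mulmxV A : (GLpair A).1 *m (GLpair A).2 = 1%:M.
Proof. by case/andP: (GLpairP A) => /eqP. Qed.

Lemma GL_mulVmx A : (GLpair A).2 *m (GLpair A).1 = 1%:M.
Proof. by case/andP: (GLpairP A) => _ /eqP. Qed.

Lemma GL_inj : injective GLmx.
Proof.
move=> A B eqAB; apply: val_inj => /=.
rewrite [GLpair A]surjective_pairing [GLpair B]surjective_pairing.
rewrite -[(GLpair A).1]/(GLmx A) eqAB; congr pair.
rewrite -[LHS]mulmx1 -(GL_mulmxV B) mulmxA.
by rewrite -[(GLpair B).1]/(GLmx B) -eqAB GL_mulVmx mul1mx.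
Qed.

Fact GL_mul_subproof1 A B :
  (GLpair A).1 *m (GLpair B).1 *m ((GLpair B).2 *m (GLpair A).2) = 1%:M.
Proof.
by rewrite mulmxA -(mulmxA (GLpair A).1) GL_mulmxV mulmx1 GL_mulmxV.
Qed.

Fact GL_mul_subproof2 A B :
  (GLpair B).2 *m (GLpair A).2 *m ((GLpair A).1 *m (GLpair B).1) = 1%:M.
Proof.
by rewrite mulmxA -(mulmxA (GLpair B).2) GL_mulVmx mulmx1 GL_mulVmx.
Qed.

Definition GL_one : GL R n := toGL (mulmx1 1%:M) (mulmx1 1%:M).
Definition GL_mul A B : GL R n :=
  toGL (GL_mul_subproof1 A B) (GL_mul_subproof2 A B).
Definition GL_inv A : GL R n := toGL (GL_mulVmx A) (GL_mulmxV A).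

Fact GL_mulA : associative GL_mul.
Proof. by move=> A B C; apply: GL_inj; rewrite /GLmx /= mulmxA. Qed.
Fact GL_mul1 : left_id GL_one GL_mul.
Proof. by move=> A; apply: GL_inj; rewrite /GLmx /= mul1mx. Qed.
Fact GL_invK : involutive GL_inv.
Proof. by move=> A; apply: GL_inj. Qed.
Fact GL_invM : {morph GL_inv : A B / GL_mul A B >-> GL_mul B A}.
Proof. by move=> A B; apply: GL_inj. Qed.
Fact GL_mulV : left_inverse GL_one GL_inv GL_mul.
Proof. by move=> A; apply: GL_inj; rewrite /GLmx /= GL_mulVmx. Qed.

HB.instance Definition _ := isStarMonoid.Build (GL R n)
  GL_mulA GL_mul1 GL_invK GL_invM.
HB.instance Definition _ := StarMonoid_isGroup.Build (GL R n) GL_mulV.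

End GLGroup.

Lemma mulmx_1D1B (R : pzRingType) n (A : 'M[R]_n) :
  A *m A = 0 -> (1%:M + A) *m (1%:M - A) = 1%:M.
Proof.
by move=> A2; rewrite mulmxDl mul1mx mulmxBr mulmx1 A2 subr0 subrK.
Qed.

Lemma mulmx_1B1D (R : pzRingType) n (A : 'M[R]_n) :
  A *m A = 0 -> (1%:M - A) *m (1%:M + A) = 1%:M.
Proof.
by move=> A2; rewrite mulmxBl mul1mx mulmxDr mulmx1 A2 addr0 addrK.
Qed.

Record pseudoInvolution (R : pzRingType) := PseudoInvolution {
  bar :> R -> R;
  bar1V : R;
  barD : {morph bar : r s / r + s};
  mul_bar1V : bar 1 * bar1V = 1;
  mul_Vbar1 : bar1V * bar 1 = 1;
  barM : forall r s, bar (r * s) = bar s * bar1V * bar r;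
  barK : involutive bar }.

Record antiHermitianForm (R : pzRingType) (J : pseudoInvolution R)
    (V : rightModType R) := AntiHermitianForm {
  form :> V -> V -> R;
  formDl : forall u v w, form (u + v) w = form u w + form v w;
  formDr : forall u v w, form u (v + w) = form u v + form u w;
  formZ : forall v w r s,
    form (v *:r r) (w *:r s) = J r * bar1V J * form v w * s;
  form_anti : forall v w, form v w = - J (form w v) }.

Definition heisenberg (R : pzRingType) (J : pseudoInvolution R)
  (V : rightModType R) (h : antiHermitianForm J V) : Type := (V * R)%type.

HB.instance Definition _ (R : pzRingType) (J : pseudoInvolution R)
    (V : rightModType R) (h : antiHermitianForm J V) :=
  Choice.copy (heisenberg h) (V * R)%type.

Section Heisenberg.
Context {R : pzRingType} {J : pseudoInvolution R} {V : rightModType R}.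
Variable h : antiHermitianForm J V.
Implicit Types x y z : heisenberg h.

Definition heis_mul x y : heisenberg h :=
  (x.1 + y.1, x.2 + y.2 + h x.1 y.1).
Definition heis_one : heisenberg h := (0, 0).
Definition heis_inv x : heisenberg h := (- x.1, h x.1 x.1 - x.2).

Lemma form0l v : h 0 v = 0.
Proof. by apply: (addrI (h 0 v)); rewrite -formDl !addr0. Qed.
Lemma form0r v : h v 0 = 0.
Proof. by apply: (addrI (h v 0)); rewrite -formDr !addr0. Qed.
Lemma formNl u v : h (- u) v = - h u v.
Proof. by apply: (addrI (h u v)); rewrite -formDl !subrr form0l. Qed.
Lemma formNr u v : h u (- v) = - h u v.
Proof. by apply: (addrI (h u v)); rewrite -formDr !subrr form0r. Qed.

Fact heis_mulA : associative heis_mul.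
Proof.
move=> x y z; rewrite /heis_mul /=; congr pair; first exact: addrA.
by rewrite formDl formDr [LHS](AC (1*3*2) ((1*2*5)*3*(6*4))).
Qed.
Fact heis_mul1 : left_id heis_one heis_mul.
Proof. by case=> v r; rewrite /heis_mul /= form0l !add0r addr0. Qed.
Fact heis_mulr1 : right_id heis_one heis_mul.
Proof. by case=> v r; rewrite /heis_mul /= form0r !addr0. Qed.
Fact heis_mulV : left_inverse heis_one heis_inv heis_mul.
Proof.
by case=> v r; rewrite /heis_mul /heis_inv /= addNr subrK formNl subrr.
Qed.
Fact heis_mulrV : right_inverse heis_one heis_inv heis_mul.
Proof.
case=> v r; rewrite /heis_mul /heis_inv /= subrr formNr addrC.
by rewrite [r + _]addrC subrK addNr.
Qed.

HB.instance Definition _ := isMonoid.Build (heisenberg h)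
  heis_mulA heis_mul1 heis_mulr1.
HB.instance Definition _ := hasInv.Build (heisenberg h) heis_inv.
HB.instance Definition _ := Monoid_isGroup.Build (heisenberg h)
  heis_mulV heis_mulrV.

Definition heis_act x (s : R) : heisenberg h :=
  (x.1 *:r s, J s * bar1V J * x.2 * s).

Definition heis_tr x : R := x.2 - J x.2 - h x.1 x.1.

Definition Lmin : set (heisenberg h) :=
  [set x | exists r : R, x = (0, r + J r)]%classic.
Definition Lmax : set (heisenberg h) := [set x | heis_tr x = 0]%classic.

Record is_odd_form_parameter (L : set (heisenberg h)) : Prop :=
  IsOddFormParameter {
  ofp_subgroup : is_subgroup L;
  ofp_min : (Lmin `<=` L)%classic;
  ofp_max : (L `<=` Lmax)%classic;
  ofp_act : forall x s, L x -> L (heis_act x s) }.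

End Heisenberg.

Record oddQuadraticForm (R : pzRingType) (J : pseudoInvolution R)
    (V : rightModType R) := OddQuadraticForm {
  qform :> antiHermitianForm J V;
  qparam : set (heisenberg qform);
  qparamP : is_odd_form_parameter qparam }.

Definition is_basis (R : pzRingType) (V : rightModType R) (n : nat)
    (f : 'I_n -> V) : Prop :=
  forall v : V, exists! a : 'cV[R]_n, v = \sum_(i < n) f i *:r a i 0.

Definition form_matrix (R : pzRingType) (J : pseudoInvolution R)
    (V : rightModType R) (h : antiHermitianForm J V) (n : nat)
    (f : 'I_n -> V) : 'M[R]_n :=
  \matrix_(i, j) h (f i) (f j).

(* [vdim m n] is n + 2 m - 1 (for m > 0, see [vdimE]), written so as to expose
   the block sizes 1, 2 (m - 1) and n. *)
Notation vdim m n := (1 + (m.-1.*2 + n))%N.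

Lemma vdimE m n : (0 < m)%N -> vdim m n = (n + 2 * m - 1)%N.
Proof.
by case: m => // m _; rewrite mul2n doubleS !addnS subn1 /= add1n addnC.
Qed.

Section Vaserstein.
Context {R : pzRingType}.
Variable J : pseudoInvolution R.

Definition psi1 : 'M[R]_(1 + 1) := block_mx 0 1%:M (- (J 1)%:M) 0.
Definition psi1' : 'M[R]_(1 + 1) := block_mx 0 (- (bar1V J)%:M) 1%:M 0.

Fixpoint psi (r : nat) : 'M[R]_(r.*2) :=
  if r is r'.+1 then (block_mx psi1 0 0 (psi r') : 'M_(2 + r'.*2)) else 0.
Fixpoint psi' (r : nat) : 'M[R]_(r.*2) :=
  if r is r'.+1 then (block_mx psi1' 0 0 (psi' r') : 'M_(2 + r'.*2)) else 0.

Variables (m n : nat) (phi : GL R n).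

Definition Psi : 'M[R]_(m.*2 + n) := block_mx (psi m) 0 0 (GLmx phi).
Definition PsiV : 'M[R]_(m.*2 + n) := block_mx (psi' m) 0 0 (GLmx phi^-1%g).

(* [vc], [vd], [mu], [rho] are the blocks of [Psi] and its inverse [PsiV], see
   [Psi_block], [PsiV_block], [mul_Psi] and [mul_PsiV]. *)
Definition vc : 'rV[R]_(vdim m n) := row_mx 1%:M 0.
Definition vd : 'rV[R]_(vdim m n) := row_mx (- (bar1V J)%:M) 0.

Definition mu : 'M[R]_(vdim m n) :=
  block_mx 0 0 0 (block_mx (psi m.-1) 0 0 (GLmx phi)).
Definition rho : 'M[R]_(vdim m n) :=
  block_mx 0 0 0 (block_mx (psi' m.-1) 0 0 (GLmx phi^-1%g)).

Definition theta (v : 'rV[R]_(vdim m n)) : 'M[R]_(vdim m n) :=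
  1%:M + vd^T *m map_mx J v *m mu.
Definition eta (v : 'rV[R]_(vdim m n)) : 'M[R]_(vdim m n) :=
  1%:M - bar1V J *: (rho *m (map_mx J v)^T *m vc).

Lemma mu_vdT : mu *m vd^T = 0.
Proof.
rewrite /mu /vd tr_row_mx mul_block_col !mul0mx !add0r trmx0 mulmx0.
by rewrite col_mx0.
Qed.

Lemma vc_rho : vc *m rho = 0.
Proof. by rewrite /vc /rho mul_row_block !mul0mx !mulmx0 !addr0 row_mx0. Qed.

Lemma theta_nil v :
  (vd^T *m map_mx J v *m mu) *m (vd^T *m map_mx J v *m mu) = 0.
Proof. by rewrite -!mulmxA (mulmxA mu) mu_vdT mul0mx !mulmx0. Qed.

Lemma eta_nil v : (- (bar1V J *: (rho *m (map_mx J v)^T *m vc))) *m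
  (- (bar1V J *: (rho *m (map_mx J v)^T *m vc))) = 0.
Proof.
set w := (map_mx J v)^T.
have vcz (z : R) : vc *m (z *: rho) = 0.
  rewrite /vc /rho scale_block_mx mul_row_block !scaler0 !mulmx0 !mul0mx.
  by rewrite !addr0 row_mx0.
by rewrite mulNmx mulmxN opprK !scalemxAl -!mulmxA (mulmxA vc) vcz mul0mx
  !mulmx0.
Qed.

Definition thetaGL v : GL R (vdim m n) :=
  @toGL R _ (theta v) _ (mulmx_1D1B (theta_nil v)) (mulmx_1B1D (theta_nil v)).
Definition etaGL v : GL R (vdim m n) :=
  @toGL R _ (eta v) _ (mulmx_1D1B (eta_nil v)) (mulmx_1B1D (eta_nil v)).

End Vaserstein.

Arguments thetaGL {R} J m {n} phi v.
Arguments etaGL {R} J m {n} phi v.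

Section VasersteinTheory.
Context {R : pzRingType}.
Variable J : pseudoInvolution R.

Lemma mul_psi1 : psi1 J *m psi1' J = 1%:M.
Proof.
rewrite /psi1 /psi1' mulmx_block !mul0mx !mulmx0 !add0r !addr0 mul1mx.
rewrite mulmxN mulNmx opprK.
by rewrite -scalar_mxM mul_bar1V -scalar_mx_block.
Qed.

Lemma mul_psi1V : psi1' J *m psi1 J = 1%:M.
Proof.
rewrite /psi1 /psi1' mulmx_block !mul0mx !mulmx0 !add0r !addr0 mul1mx.
rewrite mulmxN mulNmx opprK.
by rewrite -scalar_mxM mul_Vbar1 -scalar_mx_block.
Qed.

Lemma mul_psi r : psi J r *m psi' J r = 1%:M.
Proof.
elim: r => [|r IH]; first by apply/matrixP; case.
apply: (etrans (@mulmx_block _ 2 r.*2 2 r.*2 2 r.*2 (psi1 J) 0 0 (psi J r)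
  (psi1' J) 0 0 (psi' J r))).
rewrite mul_psi1 IH !mul0mx !mulmx0.
by rewrite !add0r !addr0 -scalar_mx_block.
Qed.

Lemma mul_psiV r : psi' J r *m psi J r = 1%:M.
Proof.
elim: r => [|r IH]; first by apply/matrixP; case.
apply: (etrans (@mulmx_block _ 2 r.*2 2 r.*2 2 r.*2 (psi1' J) 0 0 (psi' J r)
  (psi1 J) 0 0 (psi J r))).
rewrite mul_psi1V IH !mul0mx !mulmx0.
by rewrite !add0r !addr0 -scalar_mx_block.
Qed.

Lemma mul_Psi m n (phi : GL R n) : Psi J m phi *m PsiV J m phi = 1%:M.
Proof.
rewrite mulmx_block mul_psi !mul0mx !mulmx0 !add0r !addr0.
by rewrite [_ *m _]GL_mulmxV -scalar_mx_block.
Qed.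

Lemma mul_PsiV m n (phi : GL R n) : PsiV J m phi *m Psi J m phi = 1%:M.
Proof.
rewrite mulmx_block mul_psiV !mul0mx !mulmx0 !add0r !addr0.
by rewrite [_ *m _]GL_mulVmx -scalar_mx_block.
Qed.

Lemma block_diag_assoc p n (a b : R) (B : 'M[R]_p) (C : 'M[R]_n) :
  block_mx (block_mx (block_mx 0 a%:M b%:M 0 : 'M_(1 + 1)) 0 0 B : 'M_(2 + p)) 0 0 C
  = block_mx (0 : 'M_1) (row_mx a%:M 0) (col_mx b%:M 0)
      (block_mx (0 : 'M_1) 0 0 (block_mx B 0 0 C)) :> 'M_(2 + p + n).
Proof.
have /esym e1 := block_mxAx (block_mx 0 a%:M b%:M 0 : 'M[R]_(1 + 1)) 0 0 0 B 0 0 0 C.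
rewrite /= castmx_id !row_mx0 !col_mx0 in e1; rewrite {}[LHS]e1.
have /esym e2 := block_mxAx (0 : 'M_1) a%:M (0 : 'M_(1, p + n)) b%:M (0 : 'M_1)
  0 0 0 (block_mx B 0 0 C).
by rewrite /= castmx_id !row_mx0 !col_mx0 in e2.
Qed.

Lemma Psi_block m n (phi : GL R n) :
  Psi J m.+1 phi = block_mx (0 : 'M_1) (vc m.+1 n)
    (- (J 1 *: (vc m.+1 n)^T)) (mu J m.+1 phi) :> 'M_(1 + vdim m.+1 n).
Proof.
have := block_diag_assoc 1 (- J 1) (psi J m) (GLmx phi).
rewrite /vc tr_row_mx tr_scalar_mx trmx0 scale_col_mx scaler0 scale_scalar_mx.
by rewrite mulr1 opp_col_mx oppr0 raddfN.
Qed.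

Lemma PsiV_block m n (phi : GL R n) :
  PsiV J m.+1 phi = block_mx (0 : 'M_1) (vd J m.+1 n)
    (- (J 1 *: (vd J m.+1 n)^T)) (rho J m.+1 phi) :> 'M_(1 + vdim m.+1 n).
Proof.
have := block_diag_assoc (- bar1V J) 1 (psi' J m) (GLmx phi^-1%g).
rewrite (raddfN (@scalar_mx R 1)) /vd tr_row_mx trmx0 scale_col_mx scaler0.
rewrite opp_col_mx oppr0 linearN /= tr_scalar_mx scalerN opprK.
by rewrite scale_scalar_mx mul_bar1V.
Qed.

End VasersteinTheory.

Section Elementary.
Context {R : pzRingType} {N : nat}.

Definition elem_mx (i j : 'I_N) (a : R) : 'M[R]_N := 1%:M + a *: delta_mx i j.

Lemma elem_nil (i j : 'I_N) (a : R) : i != j ->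
  (a *: delta_mx i j : 'M[R]_N) *m (a *: delta_mx i j) = 0.
Proof.
move=> neq_ij; apply/matrixP=> k l; rewrite !mxE big1 // => s _; rewrite !mxE.
case: (s =P j) => [->|_]; last by rewrite andbF mulr0 mul0r.
by rewrite [j == i]eq_sym (negPf neq_ij) !mulr0.
Qed.

Definition elemGL (i j : 'I_N) (a : R) (neq_ij : i != j) : GL R N :=
  @toGL R N (elem_mx i j a) _ (mulmx_1D1B (elem_nil a neq_ij))
    (mulmx_1B1D (elem_nil a neq_ij)).

End Elementary.

Definition elementary_group (R : pzRingType) (N : nat) : set (GL R N) :=
  generated [set g | exists (i j : 'I_N) (a : R) (neq_ij : i != j),
                       g = elemGL a neq_ij]%classic.

Arguments elementary_group R N : clear implicits.

(* Main.v *)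
Require Import Defs.
From mathcomp Require Import all_boot all_order all_algebra.
From mathcomp Require Import classical_sets.

(* Write N = 1 + p and let K be the invertible lower right p x p block of mu,
   so that its inverse is the lower right block of rho. Then theta(v) is the
   block unitriangular matrix with upper right row - bar1^-1 v' K, where v' is
   the tail of bar v; as bar is bijective and both bar1 and K are invertible,
   this row is arbitrary. Likewise eta(v) is the block unitriangular matrix with
   an arbitrary lower left column. Rows and columns being sums of their entries,
   these two families generate the same group as the E_{0,j}(a) and E_{i,0}(a),
   which give the other elementary matrices by commutators. *)

Import GRing.Theory.
Local Open Scope ring_scope.
Local Open Scope classical_set_scope.

Section Generated.
Variable G : groupType.
Implicit Types X : set G.

Lemma sub_generated X : X `<=` generated X.
Proof. exact: sub_gen_smallest. Qed.

Lemma generated_is_subgroup X : is_subgroup (generated X).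
Proof.
split=> [H [Hsub _]|x y Xx Xy H HX|x Xx H HX]; first exact: subgroup1.
- by apply: (subgroupM HX.1); [exact: Xx | exact: Xy].
- by apply: (subgroupV HX.1); exact: Xx.
Qed.

Lemma generated_min X (H : set G) :
  is_subgroup H -> X `<=` H -> generated X `<=` H.
Proof. exact: smallest_sub. Qed.

End Generated.

Lemma GLmxM (R : pzRingType) n (g h : GL R n) :
  GLmx (g * h)%g = GLmx g *m GLmx h.
Proof. by []. Qed.

(** With X = a e_{ik} and Y = e_{kj}, the product XY is a e_{ij}, while XX, YY and YX vanish, the
    last because i differs from j. Hence (1+X)(1+Y)(1-X) = 1+Y+XY, and multiplying by 1-Y leaves
    1+XY. *)
Lemma elemGL_commutator (R : pzRingType) n (i j k : 'I_n) (a : R)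
    (ij : i != j) (ik : i != k) (kj : k != j) :
  elemGL a ij = (elemGL a ik * elemGL 1 kj
                 * (elemGL a ik)^-1 * (elemGL 1 kj)^-1)%g.
Proof.
apply: GL_inj; rewrite !GLmxM /GLmx /= /elem_mx.
have XY : (a *: delta_mx i k) *m (1 *: delta_mx k j) = a *: delta_mx i j.
  by rewrite scale1r -scalemxAl mul_delta_mx.
have YX : (1 *: delta_mx k j) *m (a *: delta_mx i k) = 0 :> 'M[R]_n.
  apply/matrixP=> s t; rewrite !mxE big1 // => u _; rewrite !mxE.
  case: (u =P j) => [->|_]; last by rewrite andbF mulr0 mul0r.
  by rewrite [j == i]eq_sym (negPf ij) !mulr0.
have XX := elem_nil a ik.
have YY := elem_nil (1 : R) kj.
rewrite -XY; move: XX YY YX.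
move: (a *: delta_mx i k) (1 *: delta_mx k j) => X Y XX YY YX.
have -> : (1%:M + X) *m (1%:M + Y) = 1%:M + Y + (X + X *m Y).
  by rewrite mulmxDl mul1mx mulmxDr mulmx1.
have -> : (1%:M + Y + (X + X *m Y)) *m (1%:M - X) = 1%:M + Y + X *m Y.
  rewrite mulmxBr mulmx1 !mulmxDl mul1mx YX -mulmxA YX mulmx0 XX !addr0.
  by rewrite addrA addrAC addrK.
by rewrite mulmxDl mulmx_1D1B // mulmxBr mulmx1 -mulmxA YY mulmx0 subr0.
Qed.

Section BlockTransvections.
Context {R : pzRingType} {p : nat}.
Implicit Types (w : 'rV[R]_p) (u : 'cV[R]_p).

Definition upper_mx w : 'M[R]_(1 + p) := block_mx 1%:M w 0 1%:M.
Definition lower_mx u : 'M[R]_(1 + p) := block_mx 1%:M 0 u 1%:M.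

Lemma upper_mx0 : upper_mx 0 = 1%:M.
Proof. by rewrite /upper_mx -scalar_mx_block. Qed.

Lemma lower_mx0 : lower_mx 0 = 1%:M.
Proof. by rewrite /lower_mx -scalar_mx_block. Qed.

(** Additivity provides the inverse [upper_mx (- w)] and later turns the expansion of a row in unit
    rows into a product of elementary matrices. *)
Lemma upper_mxD w w' : upper_mx (w + w') = upper_mx w *m upper_mx w'.
Proof.
rewrite /upper_mx mulmx_block !mul1mx !mulmx1 !mulmx0 !mul0mx !addr0 !add0r.
by rewrite addrC.
Qed.

Lemma lower_mxD u u' : lower_mx (u + u') = lower_mx u *m lower_mx u'.
Proof.
by rewrite /lower_mx mulmx_block !mul1mx !mulmx1 !mulmx0 !mul0mx !addr0 !add0r.
Qed.

Fact upper_mxV w : upper_mx w *m upper_mx (- w) = 1%:M.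
Proof. by rewrite -upper_mxD subrr upper_mx0. Qed.

Fact upper_Vmx w : upper_mx (- w) *m upper_mx w = 1%:M.
Proof. by rewrite -upper_mxD addNr upper_mx0. Qed.

Fact lower_mxV u : lower_mx u *m lower_mx (- u) = 1%:M.
Proof. by rewrite -lower_mxD subrr lower_mx0. Qed.

Fact lower_Vmx u : lower_mx (- u) *m lower_mx u = 1%:M.
Proof. by rewrite -lower_mxD addNr lower_mx0. Qed.

Definition upperGL w : GL R (1 + p) := toGL (upper_mxV w) (upper_Vmx w).
Definition lowerGL u : GL R (1 + p) := toGL (lower_mxV u) (lower_Vmx u).

Lemma upperGL0 : upperGL 0 = 1%g.
Proof. exact/GL_inj/upper_mx0. Qed.

Lemma lowerGL0 : lowerGL 0 = 1%g.
Proof. exact/GL_inj/lower_mx0. Qed.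

Lemma upperGLD w w' : upperGL (w + w') = (upperGL w * upperGL w')%g.
Proof. exact/GL_inj/upper_mxD. Qed.

Lemma lowerGLD u u' : lowerGL (u + u') = (lowerGL u * lowerGL u')%g.
Proof. exact/GL_inj/lower_mxD. Qed.

(** [elemGL] depends on a proof that its indices differ; that proof is left arbitrary so that every
    instance can be rewritten. *)
Lemma elemGL_upper (j : 'I_p) (a : R) (neq : lshift p 0 != rshift 1 j) :
  elemGL a neq = upperGL (a *: delta_mx 0 j).
Proof.
apply: GL_inj; rewrite /GLmx /= /elem_mx /upper_mx delta_mx_ushift.
(* Exposing the width [1 + p] lets the zero block split in two, so that the unit matrix becomes a
   [block_mx]. *)
rewrite delta_mx_rshift -[col_mx _ 0]/(col_mx _ (0 : 'M_(p, 1 + p))) -row_mx0.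
rewrite -[col_mx _ _]/(block_mx 0 (delta_mx 0 j) 0 0) scale_block_mx.
by rewrite (scalar_mx_block 1 p) add_block_mx !scaler0 !addr0 add0r.
Qed.

Lemma elemGL_lower (i : 'I_p) (a : R) (neq : rshift 1 i != lshift p 0) :
  elemGL a neq = lowerGL (a *: delta_mx i 0).
Proof.
apply: GL_inj; rewrite /GLmx /= /elem_mx /lower_mx delta_mx_dshift.
rewrite delta_mx_lshift -[col_mx 0 _]/(col_mx (0 : 'M_(1, 1 + p)) _) -row_mx0.
rewrite -[col_mx _ _]/(block_mx 0 0 (delta_mx i 0) 0) scale_block_mx.
by rewrite (scalar_mx_block 1 p) add_block_mx !scaler0 !addr0 add0r.
Qed.

Lemma elementary_upperGL w : elementary_group R (1 + p) (upperGL w).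
Proof.
have [E1 EM _] := generated_is_subgroup _
  [set g | exists (i j : 'I_(1 + p)) (a : R) (neq_ij : i != j),
             g = elemGL a neq_ij].
rewrite [w]row_sum_delta.
apply: (big_ind (fun w => elementary_group R (1 + p) (upperGL w))).
- by rewrite upperGL0.
- by move=> w1 w2 Ew1 Ew2; rewrite upperGLD; apply: EM.
move=> j _; have neq : lshift p 0 != rshift 1 j by rewrite eq_lrshift.
by rewrite -(elemGL_upper _ _ neq); apply: sub_generated; do 4![eexists].
Qed.

Lemma elementary_lowerGL u : elementary_group R (1 + p) (lowerGL u).
Proof.
have [E1 EM _] := generated_is_subgroup _
  [set g | exists (i j : 'I_(1 + p)) (a : R) (neq_ij : i != j),
             g = elemGL a neq_ij].
rewrite [u]matrix_sum_delta.
apply: (big_ind (fun u => elementary_group R (1 + p) (lowerGL u))).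
- by rewrite lowerGL0.
- by move=> u1 u2 Eu1 Eu2; rewrite lowerGLD; apply: EM.
(* The inner sum runs over the single column of [u]. *)
move=> i _; rewrite big_ord1.
have neq : rshift 1 i != lshift p 0 by rewrite eq_rlshift.
by rewrite -(elemGL_lower _ _ neq); apply: sub_generated; do 4![eexists].
Qed.

Lemma elementary_sub (H : set (GL R (1 + p))) : is_subgroup H ->
    (forall w, H (upperGL w)) -> (forall u, H (lowerGL u)) ->
  elementary_group R (1 + p) `<=` H.
Proof.
move=> Hsub Hup Hlow; apply: generated_min => // g [i [j [a [neq ->{g}]]]].
case: (split_ordP i) (split_ordP j) neq => i' -> [] j' -> neq.
- by case/eqP: (neq); rewrite !ord1.
- by move: neq; rewrite ord1 => neq; rewrite elemGL_upper.
- by move: neq; rewrite [j']ord1 => neq; rewrite elemGL_lower.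
(* Both indices lie in the tail: the commutator passes through index 0, with one lower and one upper
   factor. *)
have neq_i : rshift 1 i' != lshift p 0 by rewrite eq_rlshift.
have neq_j : lshift p 0 != rshift 1 j' by rewrite eq_lrshift.
rewrite (elemGL_commutator _ _ _ _ _ _ neq neq_i neq_j).
rewrite elemGL_lower elemGL_upper; case: Hsub => _ HM HV.
by apply: (HM _ _ (HM _ _ (HM _ _ _ _) _) _); try apply: HV.
Qed.

End BlockTransvections.

Section VasersteinGenerators.
Context {R : pzRingType} (J : pseudoInvolution R) (m n : nat) (phi : GL R n).

Let p := (m.-1.*2 + n)%N.
Let K : 'M[R]_p := block_mx (psi J m.-1) 0 0 (GLmx phi).
Let KV : 'M[R]_p := block_mx (psi' J m.-1) 0 0 (GLmx phi^-1%g).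

Let mulKVK : KV *m K = 1%:M.
Proof.
rewrite mulmx_block mul_psiV !mul0mx !mulmx0 !add0r !addr0.
by rewrite [_ *m _]GL_mulVmx -scalar_mx_block.
Qed.

Let map_barK k l (A : 'M[R]_(k, l)) : map_mx J (map_mx J A) = A.
Proof. by apply/matrixP=> i j; rewrite !mxE barK. Qed.

(** The zero first row of [mu] discards the first entry of [v], its zero first column clears the
    first column of the product, and [vd^T] is supported in the first row; only the upper right
    block survives. *)
Lemma thetaE (v : 'rV[R]_(1 + p)) : theta J phi v =
  upper_mx (- (bar1V J *: (rsubmx (map_mx J v) *m K))).
Proof.
rewrite /theta /upper_mx -mulmxA -{1}[map_mx J v]hsubmxK.
rewrite /mu -/K mul_row_block !mulmx0 !add0r.
rewrite /vd tr_row_mx linearN /= tr_scalar_mx trmx0 mul_col_row.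
rewrite !mul0mx mulmx0 mulNmx mul_scalar_mx (scalar_mx_block 1 p).
by rewrite add_block_mx !addr0 add0r.
Qed.

(** Dually, [rho] kills the first entry on both sides, and [vc] puts the resulting column in the
    first column. *)
Lemma etaE (v : 'rV[R]_(1 + p)) : eta J phi v =
  lower_mx (- (bar1V J *: (KV *m (rsubmx (map_mx J v))^T))).
Proof.
rewrite /eta /lower_mx -{1}[map_mx J v]hsubmxK tr_row_mx.
rewrite /rho -/KV mul_block_col !mul0mx !add0r.
rewrite /vc mul_col_row !mul0mx mulmx0 mulmx1 (scalar_mx_block 1 p).
by rewrite scale_block_mx opp_block_mx add_block_mx !scaler0 !subr0 add0r.
Qed.

Lemma thetaGLE (v : 'rV[R]_(1 + p)) : thetaGL J m phi v =
  upperGL (- (bar1V J *: (rsubmx (map_mx J v) *m K))).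
Proof. exact/GL_inj/thetaE. Qed.

Lemma etaGLE (v : 'rV[R]_(1 + p)) : etaGL J m phi v =
  lowerGL (- (bar1V J *: (KV *m (rsubmx (map_mx J v))^T))).
Proof. exact/GL_inj/etaE. Qed.

Lemma upperGL_range : range upperGL `<=` range (thetaGL J m phi).
Proof.
(* The tail solves - bar1^-1 v' K = w for v', followed by bar, which is its own inverse; the free
   first entry is set to 0. *)
move=> _ [w _ <-]; exists (row_mx 0 (map_mx J (- (J 1 *: w) *m KV))) => //.
rewrite thetaGLE map_row_mx row_mxKr map_barK -mulmxA mulKVK mulmx1.
by rewrite scalerN opprK scalerA mul_Vbar1 scale1r.
Qed.

Lemma lowerGL_range : range lowerGL `<=` range (etaGL J m phi).
Proof.
move=> _ [u _ <-].
(* Here the unknown column stands to the right of [KV], so bar1 must scale [u] before [K] is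
   applied: [R] need not be commutative. *)
exists (row_mx 0 (map_mx J (- (K *m (J 1 *: u)))^T)) => //.
rewrite etaGLE map_row_mx row_mxKr map_barK trmxK.
rewrite mulmxN mulmxA mulKVK mul1mx.
by rewrite scalerN opprK scalerA mul_Vbar1 scale1r.
Qed.

End VasersteinGenerators.

Theorem theorem1p2 (R : pzRingType) (J : pseudoInvolution R) (m n : nat)
    (hm : (0 < m)%N) (hn : (0 < n)%N)
    (V0 : rightModType R) (q0 : oddQuadraticForm J V0)
    (f : 'I_n -> V0) (hf : is_basis f)
    (phi : GL R n) (hphi : GLmx phi = form_matrix q0 f) :
  generated (range (thetaGL J m phi) `|` range (etaGL J m phi)) =
  elementary_group R (vdim m n).
Proof.
rewrite eqEsubset; split.
  apply: generated_min; first exact: generated_is_subgroup.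
  move=> _ [] [v _ <-]; rewrite ?thetaGLE ?etaGLE.
    exact: elementary_upperGL.
  exact: elementary_lowerGL.
apply: elementary_sub; first exact: generated_is_subgroup.
- move=> w; apply: sub_generated; left.
  by apply: upperGL_range; exists w.
- move=> u; apply: sub_generated; right.
  by apply: lowerGL_range; exists u.
Qed.
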